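(* Let $\mathcal{H}$ be a complex Hilbert space, let $\mathfrak{M}\subseteq B(\mathcal{H})$ be a von Neumann algebra with commutant $\mathfrak{M}'$, and let $\xi\in\mathcal{H}$, $\|\xi\|=1$, be a cyclic and separating vector for $\mathfrak{M}$. Define conjugate-linear operators in $\mathcal{H}$ by $\operatorname{dom}S_\xi=\mathfrak{M}\xi$, $S_\xi(m\xi)=m^\star\xi$ for $m\in\mathfrak{M}$, and $\operatorname{dom}F_\xi=\mathfrak{M}'\xi$, $F_\xi(m'\xi)=(m')^\star\xi$ for $m'\in\mathfrak{M}'$. Then $(S_\xi,F_\xi)$ is a symmetric pair, and thus $S_\xi$ and $F_\xi$ are closable operators and $$S_\xi\subseteq F_\xi^\star\qquad\text{and}\qquad F_\xi\subseteq S_\xi^\star .$$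
   Context: $\mathfrak{M}'=\{x\in B(\mathcal{H}): xm=mx\ \forall m\in\mathfrak{M}\}$. The unit vector $\xi$ is $\mathfrak{M}$-cyclic if $\mathfrak{M}\xi=\{m\xi:m\in\mathfrak{M}\}$ is dense in $\mathcal{H}$, and $\mathfrak{M}$-separating if $\mathfrak{M}'\xi=\{m'\xi:m'\in\mathfrak{M}'\}$ is dense in $\mathcal{H}$ (equivalently, $m\xi=0$ with $m\in\mathfrak{M}$ implies $m=0$). A pair $(A,B)$ of densely defined conjugate-linear operators $A:\operatorname{dom}A\subseteq\mathcal{H}_1\to\mathcal{H}_2$, $B:\operatorname{dom}B\subseteq\mathcal{H}_2\to\mathcal{H}_1$ is a symmetric pair if $\langle A\varphi,\psi\rangle_{\mathcal{H}_2}=\overline{\langle\varphi,B\psi\rangle_{\mathcal{H}_1}}$ for all $\varphi\in\operatorname{dom}A$, $\psi\in\operatorname{dom}B$. The adjoint of a densely defined conjugate-linear operator $A$ is the conjugate-linear operator $A^\star$ determined by $\langle A\varphi,\psi\rangle=\overline{\langle\varphi,A^\star\psi\rangle}$ for all $\varphi\in\operatorname{dom}A$, its domain consisting of all $\psi$ for which such a vector $A^\star\psi$ exists. An operator is closable if the closure of its graph is the graph of an operator. $A\subseteq B$ means that $B$ extends $A$. *)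

(* Defs.v *)
From HB Require Import structures.
From mathcomp Require Import all_boot all_order all_algebra.
From mathcomp Require Import complex.
From mathcomp Require Import all_classical all_reals topology normedtype.

Set Implicit Arguments.
Unset Strict Implicit.
Unset Printing Implicit Defensive.

Import Order.TTheory GRing.Theory Num.Theory.
Import numFieldNormedType.Exports.

Local Open Scope classical_set_scope.
Local Open Scope ring_scope.
Local Open Scope complex_scope.

HB.mixin Record CompleteNormedModule_isHilbert (R : realType) H
    of CompleteNormedModule R[i] H := {
  inner : H -> H -> R[i] ;
  innerPl : forall (a : R[i]) (x y z : H),
    inner (a *: x + y) z = a * inner x z + inner y z ;
  innerC : forall x y : H, inner x y = Num.conj (inner y x) ;
  inner_norm : forall x : H, inner x x = `|x| ^+ 2
}.

#[short(type="hilbertType")]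
HB.structure Definition Hilbert (R : realType) :=
  {H of CompleteNormedModule R[i] H & CompleteNormedModule_isHilbert R H}.

Section InnerIsDot.
Variables (R : realType) (H : hilbertType R).

Let inner_bilinear :
  bilinear_for *%R (Num.conj \; *%R) (inner : H -> H -> R[i]).
Proof.
split=> [z a x y|z a x y] /=; first exact: innerPl.
by rewrite innerC innerPl rmorphD rmorphM /= -!innerC.
Qed.

HB.instance Definition _ :=
  bilinear_isBilinear.Build R[i] H H R[i] *%R (Num.conj \; *%R)
    (inner : H -> H -> R[i]) inner_bilinear.

Let inner_herm (x y : H) : inner x y = (-1) ^+ false * Num.conj (inner y x).
Proof. by rewrite mul1r innerC. Qed.

HB.instance Definition _ :=
  isHermitianSesquilinear.Build R[i] H false Num.conj
    (inner : H -> H -> R[i]) inner_herm.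

Let inner_gt0 (x : H) : x != 0 -> 0 < inner x x.
Proof. by move=> x0; rewrite inner_norm exprn_gt0 // normr_gt0. Qed.

HB.instance Definition _ :=
  isDotProduct.Build R[i] H (inner : H -> H -> R[i]) inner_gt0.

End InnerIsDot.

Notation "''[' x , y ]" := (inner x y)
  (format "''[' x ,  y ]") : ring_scope.

Section BoundedOperators.
Context {R : realType} {H : hilbertType R}.
Implicit Types (T : H -> H) (M : set (H -> H)) (xi : H).

Definition bounded_operators : set (H -> H) :=
  [set T | linear T /\ exists c : R[i], forall x, `|T x| <= c * `|x|].

(* By the Riesz representation theorem the set below is a singleton when T is
   bounded, so that the default value is irrelevant. *)
Definition hadjoint T : H -> H :=
  xget (fun=> 0) [set T' | bounded_operators T' /\
                           forall x y, '[T x, y] = '[x, T' y]].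

Definition commutant M : set (H -> H) :=
  [set x | bounded_operators x /\ forall m, M m -> x \o m = m \o x].

(* Its initial topology is the coarsest one making T |-> '[T x, y] continuous
   for all x and y; on bounded operators it is the weak operator topology. *)
Definition matrix_coefficients T : {ptws H * H -> R[i]^o} :=
  fun z => '[T z.1, z.2].

Definition von_neumann_algebra M : Prop :=
  [/\ M `<=` bounded_operators,
      M id,
      (forall (a : R[i]) m n, M m -> M n -> M (fun x => a *: m x + n x)),
      (forall m n, M m -> M n -> M (m \o n)) &
      (forall m, M m -> M (hadjoint m))] /\
  bounded_operators `&` closure (M : set (initial_topology matrix_coefficients)) `<=` M.

Definition orbit M xi : set H := [set m xi | m in M].

Definition cyclic_vector M xi : Prop := dense (orbit M xi).

Definition separating_vector M xi : Prop := dense (orbit (commutant M) xi).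

End BoundedOperators.

(* Operators with a domain are represented by their graphs; [A] extends [B] when
   [B `<=` A]. *)
Section ConjugateLinearOperators.
Context {R : realType}.
Implicit Types H : hilbertType R.

Definition conjugate_linear_operator H1 H2 (A : set (H1 * H2)) : Prop :=
  [/\ A (0, 0),
      (forall x1 y1 x2 y2, A (x1, y1) -> A (x2, y2) -> A (x1 + x2, y1 + y2)),
      (forall (a : R[i]) x y, A (x, y) -> A (a *: x, Num.conj a *: y)) &
      (forall x y1 y2, A (x, y1) -> A (x, y2) -> y1 = y2)].

Definition domain H1 H2 (A : set (H1 * H2)) : set H1 := [set p.1 | p in A].

Definition densely_defined H1 H2 (A : set (H1 * H2)) : Prop := dense (domain A).

Definition symmetric_pair H1 H2 (A : set (H1 * H2)) (B : set (H2 * H1)) : Prop :=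
  [/\ conjugate_linear_operator A, densely_defined A,
      conjugate_linear_operator B, densely_defined B &
      forall phi Aphi psi Bpsi, A (phi, Aphi) -> B (psi, Bpsi) ->
        '[Aphi, psi] = Num.conj '[phi, Bpsi]].

Definition adjoint H1 H2 (A : set (H1 * H2)) : set (H2 * H1) :=
  [set q | forall phi Aphi, A (phi, Aphi) ->
     '[Aphi, q.1] = Num.conj '[phi, q.2]].

Definition closable H1 H2 (A : set (H1 * H2)) : Prop :=
  conjugate_linear_operator (closure A).

Definition S_op H (M : set (H -> H)) (xi : H) : set (H * H) :=
  [set (m xi, hadjoint m xi) | m in M].

Definition F_op H (M : set (H -> H)) (xi : H) : set (H * H) :=
  [set (m' xi, hadjoint m' xi) | m' in commutant M].

End ConjugateLinearOperators.

(* Main.v *)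
Require Import Defs.
From mathcomp Require Import all_boot all_order all_algebra.
From mathcomp Require Import complex.
From mathcomp Require Import all_classical all_reals topology normedtype.
From mathcomp Require Import ring lra.

Import Order.TTheory GRing.Theory Num.Theory.
Import numFieldNormedType.Exports.

(* For m in M and m' in M' both <m* xi, m' xi> and <m'* xi, m xi> equal
   <xi, m m' xi> = <xi, m' m xi>. Since M xi and M' xi are dense, this identity
   shows that m* xi depends only on m xi, that m'* xi depends only on m' xi, and
   that the two operators form a symmetric pair. Each operator of a symmetric
   pair lies in the adjoint of the other, which is a closed graph, so that both
   are closable. The existence of m* is obtained from the Riesz representation
   theorem. *)

Local Open Scope classical_set_scope.
Local Open Scope ring_scope.

(** * Inner product: sesquilinearity, Cauchy-Schwarz, continuity, orthogonality to dense sets *)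

Section InnerProduct.
Context {R : realType} {H : hilbertType R}.
Implicit Types (x y z : H) (a : R[i]).

Lemma innerDl x y z : '[x + y, z] = '[x, z] + '[y, z].
Proof. by have := innerPl 1 x y z; rewrite scale1r mul1r. Qed.

Lemma inner0l z : '[0 : H, z] = 0.
Proof. by apply: (addrI '[0, z]); rewrite -innerDl !addr0. Qed.

Lemma innerZl a x z : '[a *: x, z] = a * '[x, z].
Proof. by have := innerPl a x 0 z; rewrite inner0l !addr0. Qed.

Lemma innerNl x z : '[- x, z] = - '[x, z].
Proof. by rewrite -scaleN1r innerZl mulN1r. Qed.

Lemma innerBl x y z : '[x - y, z] = '[x, z] - '[y, z].
Proof. by rewrite innerDl innerNl. Qed.

Lemma innerDr x y z : '[z, x + y] = '[z, x] + '[z, y].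
Proof. by rewrite innerC innerDl rmorphD /= -!innerC. Qed.

Lemma inner0r z : '[z, 0 : H] = 0.
Proof. by rewrite innerC inner0l conjC0. Qed.

Lemma innerZr a x z : '[z, a *: x] = Num.conj a * '[z, x].
Proof. by rewrite innerC innerZl rmorphM /= -innerC. Qed.

Lemma innerNr x z : '[z, - x] = - '[z, x].
Proof. by rewrite innerC innerNl rmorphN /= -innerC. Qed.

Lemma innerBr x y z : '[z, x - y] = '[z, x] - '[z, y].
Proof. by rewrite innerDr innerNr. Qed.

Lemma inner_eq0 x : '[x, x] = 0 -> x = 0.
Proof. by rewrite inner_norm => /eqP; rewrite expf_eq0 /= normr_eq0 => /eqP. Qed.

Lemma inner_injl x y : (forall z, '[x, z] = '[y, z]) -> x = y.
Proof.
by move=> xy; apply/subr0_eq/inner_eq0; rewrite innerBl xy subrr.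
Qed.

(** The squared norm of [|y|^2 x - <x, y> y] expands to [|y|^2 (|x|^2 |y|^2 - |<x, y>|^2)], and the
    positive factor [|y|^2] cancels when [y] is nonzero. *)
Lemma inner_CauchySchwarz x y : `|'[x, y]| <= `|x| * `|y|.
Proof.
have [->|y0] := eqVneq y 0; first by rewrite inner0r !normr0 mulr0.
have ny : 0 < `|y| ^+ 2 by rewrite exprn_gt0 // normr_gt0.
rewrite -ler_sqr ?nnegrE ?mulr_ge0 // exprMn -subr_ge0.
rewrite -(pmulr_rge0 _ ny).
have : 0 <= `|(`|y| ^+ 2) *: x - '[x, y] *: y| ^+ 2 by rewrite exprn_ge0.
rewrite -inner_norm !(innerBl, innerBr, innerZl, innerZr) !inner_norm.
have -> : Num.conj (`|y| ^+ 2) = `|y| ^+ 2.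
  by apply/CrealP; rewrite realX // normr_real.
rewrite (innerC y x) normCK.
set c := Num.conj _; set a := '[x, y].
by congr (0 <= _); ring.
Qed.

Lemma inner_continuous_l y : continuous (fun x : H => '[x, y] : R[i]^o).
Proof.
move=> x; apply/cvgrPdist_lt => e e0.
(* The [+ 1] keeps the divisor positive when [y = 0]. *)
have y1 : 0 < `|y| + 1 by rewrite ltr_wpDl.
have /cvgrPdist_lt/(_ _ (divr_gt0 e0 y1)) : id @ x --> x by exact: cvg_id.
apply: filterS => z; rewrite ltr_pdivlMr // => xz.
rewrite -innerBl; apply: le_lt_trans (inner_CauchySchwarz _ _) _.
by apply: le_lt_trans xz; rewrite ler_wpM2l // lerDl.
Qed.

Lemma inner_continuous_r x : continuous (fun y : H => '[x, y] : R[i]^o).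
Proof.
move=> y; apply/cvgrPdist_lt => e e0.
have /cvgrPdist_lt/(_ e e0) := @inner_continuous_l x y.
apply: filterS => z; rewrite -innerBl -innerBr.
by rewrite (innerC x) norm_conjC.
Qed.

(** The vectors orthogonal to [x] form a closed set. If [x] were nonzero, the complement would be an
    open set containing [x], hence would meet [D]. *)
Lemma dense_orthogonal0 (D : set H) x :
  dense D -> (forall z, D z -> '[x, z] = 0) -> x = 0.
Proof.
move=> dD xD; apply: inner_eq0; apply: contrapT => x0.
have cl : closed [set z | '[x, z] = 0].
  apply: (@preimage_closed _ _ (fun y : H => '[x, y] : R[i]^o) [set 0]).
    by move=> z _; exact: inner_continuous_r.
  exact/accessible_closed_set1/hausdorff_accessible/norm_hausdorff.
have [z [/= z0 /xD]] : ~` [set z | '[x, z] = 0] `&` D !=set0.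
  by apply: dD; [exists x|rewrite openC].
exact: z0.
Qed.

End InnerProduct.


(** * Real parts of complex numbers *)

Section RealParts.
Context {R : realType}.
Implicit Types a b : R[i].

Lemma ReD a b : complex.Re (a + b) = complex.Re a + complex.Re b.
Proof. by case: a; case: b. Qed.

Lemma ReN a : complex.Re (- a) = - complex.Re a.
Proof. by case: a. Qed.

Lemma ReZ (t : R) a : complex.Re (t%:C%C * a) = t * complex.Re a.
Proof. by case: a => u v /=; rewrite mul0r subr0. Qed.

Lemma Re_conj a : complex.Re (Num.conj a) = complex.Re a.
Proof. by case: a. Qed.

Lemma Re_le_norm a : complex.Re a <= complex.Re `|a|.
Proof.
have := normc_ge_Re a; rewrite lecE => /andP[_]; apply: le_trans.
exact: ler_norm.
Qed.

(** The choices [u = 1] and [u = 'i] recover the real and the imaginary part. *)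
Lemma Re_ext a b : (forall u, complex.Re (u * a) = complex.Re (u * b)) -> a = b.
Proof.
move=> ab; have := ab 1; have := ab ('i)%C.
case: a {ab} => a1 a2; case: b => b1 b2 /=.
by rewrite !mul1r !mul0r => i1 i2; congr Complex; lra.
Qed.

End RealParts.

(** * Riesz representation by minimization of a quadratic functional *)

Section Riesz.
Context {R : realType} {H : hilbertType R}.
Implicit Types x y z : H.

(** The norm takes values in [R[i]], whose order is only partial; the minimization needs a norm in
    the ordered field [R]. *)
Definition rnorm x : R := complex.Re `|x|.

Lemma ler_Re {a b : R[i]} : a <= b -> complex.Re a <= complex.Re b.
Proof. by rewrite lecE => /andP[]. Qed.

Lemma normE x : `|x| = (rnorm x)%:C%C.
Proof. by rewrite /rnorm RRe_real // normr_real. Qed.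

Lemma rnorm_ge0 x : 0 <= rnorm x.
Proof. by have := ler_Re (normr_ge0 x). Qed.

Lemma sqr_rnorm x : rnorm x ^+ 2 = complex.Re '[x, x].
Proof. by rewrite inner_norm normE -rmorphXn. Qed.

Lemma sqr_rnormD x y :
  rnorm (x + y) ^+ 2 = rnorm x ^+ 2 + 2 * complex.Re '[x, y] + rnorm y ^+ 2.
Proof.
rewrite !sqr_rnorm innerDl !innerDr !ReD (innerC y x) Re_conj; lra.
Qed.

Lemma Re_inner_ge x y : - (rnorm x * rnorm y) <= complex.Re '[x, y].
Proof.
have := le_trans (Re_le_norm _) (ler_Re (inner_CauchySchwarz (- x) y)).
by rewrite innerNl ReN lerNl normrN !normE -rmorphM.
Qed.

Lemma rnormZ (t : R) x : rnorm (t%:C%C *: x) = `|t| * rnorm x.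
Proof.
rewrite /rnorm normrZ normE (_ : `|t%:C%C| = `|t|%:C%C) ?ReZ //.
by rewrite normc_def /= expr0n addr0 sqrtr_sqr.
Qed.

Variables (f : H -> R[i]) (k : R).
Hypotheses (fD : forall x y, f (x + y) = f x + f y)
  (fZ : forall a x, f (a *: x) = a * f x) (k0 : 0 <= k)
  (fk : forall x, `|f x| <= k%:C%C * `|x|).

(* A minimizer z of J represents f: the derivative of J at z in the direction w
   is 2 Re ('[z, w] - f w). *)
Let J x := rnorm x ^+ 2 - 2 * complex.Re (f x).

Let JD x y :
  J (x + y) = J x + 2 * (complex.Re '[x, y] - complex.Re (f y)) + rnorm y ^+ 2.
Proof. rewrite /J sqr_rnormD fD ReD; lra. Qed.

Let fN x : f (- x) = - f x.
Proof. by rewrite -scaleN1r fZ mulN1r. Qed.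

Let Re_f_le x : complex.Re (f x) <= k * rnorm x.
Proof.
apply: le_trans (Re_le_norm _) _.
by have := ler_Re (fk x); rewrite normE -rmorphM.
Qed.

(** [J x] is at least [|x|^2 - 2 k |x| = (|x| - k)^2 - k^2]. *)
Let J_lbound : lbound (range J) (- k ^+ 2).
Proof.
move=> _ [x _ <-]; rewrite /J; have := Re_f_le x.
have := sqr_ge0 (rnorm x - k); nra.
Qed.

Let J_has_inf : has_inf (range J).
Proof. by split; [exists (J 0); exists 0|exists (- k ^+ 2)]. Qed.

Let d := inf (range J).

Let d_le x : d <= J x.
Proof. by apply: ge_inf; [case: J_has_inf|exists x]. Qed.

Let near_min (e : R) : set H := [set x | J x < d + e].

Let near_min_nonempty e : 0 < e -> near_min e !=set0.
Proof.
move=> e0; have [_ [x _ <-] xe] := inf_adherent e0 J_has_inf.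
by exists x.
Qed.

(** Parallelogram law: with midpoint [m] and half-difference [h],
    [J (m + h) + J (m - h) = 2 J m + 2 |h|^2]. As [J m >= d], this forces [|h|^2 < e], and
    [x - y = 2 h]. *)
Let near_min_diam e x y :
  near_min e x -> near_min e y -> rnorm (x - y) ^+ 2 < 4 * e.
Proof.
rewrite /near_min /= => xe ye.
pose h := (2^-1)%:C%C *: (x - y); pose m := y + h.
have xy2 : x - y = h + h.
  have half2 : 2^-1 + 2^-1 = 1 :> R by lra.
  by rewrite -scalerDl -rmorphD half2 scale1r.
have xE : x = m + h by rewrite /m -addrA -xy2 addrC subrK.
have yE : y = m - h by rewrite /m addrK.
have hN : rnorm (- h) = rnorm h by rewrite /rnorm normrN.
have := d_le m.
rewrite xy2 sqr_rnormD -sqr_rnorm.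
move: xe ye; rewrite xE yE !JD innerNr fN !ReN hN; lra.
Qed.

Let minimizing : set_system H := filter_from [set e | 0 < e] near_min.

Let minimizing_filter : ProperFilter minimizing.
Proof.
apply: filter_from_proper => [|e e0]; last exact: near_min_nonempty.
apply: filter_from_filter => [|e1 e2 /= e10 e20]; first by exists 1; rewrite /=.
exists (Num.min e1 e2); first by rewrite /= lt_min e10.
move=> x; rewrite /near_min /= => xe; split; apply: lt_le_trans xe _;
  by rewrite lerD2l ge_min lexx ?orbT.
Qed.

Let ballE (r : R) x y : ball x r%:C%C y <-> rnorm (x - y) < r.
Proof. by rewrite -ball_normE /= normE ltcR. Qed.

Let minimizing_cvg : exists z, minimizing --> z.
Proof.
have Fmin := minimizing_filter.
apply/cvg_ex; apply: cauchy_cvg; apply: cauchy_exP => eps eps0.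
(* Radii of balls lie in [R[i]]; a positive one is real. *)
have epsE : eps = (complex.Re eps)%:C%C by rewrite RRe_real // gtr0_real.
move: eps0; rewrite epsE; set r := complex.Re eps => r0.
have {}r0 : 0 < r by rewrite -ltcR.
(* By [near_min_diam], this level makes all distances smaller than [r]. *)
have r4 : 0 < r ^+ 2 / 4 by rewrite divr_gt0 // exprn_gt0.
have [x xr] := near_min_nonempty _ r4.
exists x, (r ^+ 2 / 4) => // y yr; apply/ballE.
rewrite -ltr_sqr ?nnegrE ?rnorm_ge0 // 1?ltW //.
by have := near_min_diam _ _ _ xr yr; lra.
Qed.

Let J_min : exists z, forall x, J z <= J x.
Proof.
have [z cz] := minimizing_cvg; exists z => x.
apply: le_trans (d_le x); apply/ler_addgt0Pr => e e0.
(* Moving from [z] to [w] lowers [J] by at most [2 c |z - w|]. The radius [r] keeps this loss below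
   [e / 2]; the other [e / 2] is the excess of [J w] over [d]. The [+ 1] in [r] covers [c = 0]. *)
pose c := rnorm z + k; have c0 : 0 <= c by rewrite addr_ge0 ?rnorm_ge0.
pose r := e / (4 * (c + 1)).
have r0 : 0 < r by rewrite divr_gt0 //; lra.
have rc : r * (4 * (c + 1)) = e by rewrite divfK //; lra.
have [|e1 /= e10 sub] := cz (ball z r%:C%C).
  by apply: nbhsx_ballx; rewrite ltcR.
have [w we] : near_min (Num.min e1 (e / 2)) !=set0.
  by apply: near_min_nonempty; rewrite lt_min e10 divr_gt0.
have /sub/ballE wz : near_min e1 w.
  by apply: lt_le_trans we _; rewrite lerD2l ge_min lexx.
have {we} wJ : J w < d + e / 2.
  by apply: lt_le_trans we _; rewrite lerD2l ge_min lexx orbT.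
have hN : rnorm (w - z) = rnorm (z - w) by rewrite /rnorm distrC.
have := JD z (w - z); rewrite [z + _]addrC subrK hN.
have := Re_inner_ge z (w - z); have := Re_f_le (w - z); rewrite hN.
have := rnorm_ge0 (z - w); rewrite /c in c0 rc; move: (rnorm (z - w)) wz => t.
nra.
Qed.

Lemma Riesz_representation : exists z, forall x, f x = '[x, z].
Proof.
have [z zJ] := J_min; exists z.
have crit w : complex.Re '[z, w] = complex.Re (f w).
  pose n := rnorm w ^+ 2; have n0 : 0 <= n by rewrite sqr_ge0.
  pose b := complex.Re '[z, w] - complex.Re (f w).
  (* Minimality gives [0 <= 2 t b + t^2 n]. Since [b = - t (n + 1)], the right side is
     [- t^2 (n + 2)], so [t] and [b] vanish. The [+ 1] covers [w = 0]. *)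
  pose t := - b / (n + 1).
  have tn : t * (n + 1) = - b by rewrite divfK //; lra.
  have := zJ (z + t%:C%C *: w); rewrite JD rnormZ exprMn real_normK ?num_real //.
  rewrite fZ innerZr (_ : Num.conj _ = t%:C%C); last exact: conjc_real.
  rewrite !ReZ -mulrBr -/b -/n => ge0.
  have b0 : b = 0 by nra.
  by move: b0; rewrite /b; lra.
(* Only real parts are known to agree; applying [crit] to all multiples [u *: x] yields the complex
   identity. *)
move=> x; apply: Re_ext => u.
by rewrite -fZ -crit -Re_conj -innerC innerZl.
Qed.

End Riesz.

(** * Adjoints of bounded operators, and the operators defined by two commuting families *)

Section Adjoint.
Context {R : realType} {H : hilbertType R}.
Implicit Types (T m : H -> H) (x y xi : H) (K L : set (H -> H)).

Lemma bounded_operatorD {T} (bT : bounded_operators T) x y :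
  T (x + y) = T x + T y.
Proof. by have := bT.1 1 x y; rewrite !scale1r. Qed.

Lemma bounded_operator0 {T} (bT : bounded_operators T) : T 0 = 0.
Proof. by apply: (addrI (T 0)); rewrite -(bounded_operatorD bT) !addr0. Qed.

Lemma bounded_operatorZ {T} (bT : bounded_operators T) (a : R[i]) x :
  T (a *: x) = a *: T x.
Proof. by have := bT.1 a x 0; rewrite (bounded_operator0 bT) !addr0. Qed.

(** On the zero space the given [c] can be any complex number, hence the passage to its modulus. *)
Lemma bounded_operator_constant T : bounded_operators T ->
  exists2 k : R, 0 <= k & forall x, `|T x| <= k%:C%C * `|x|.
Proof.
move=> [_ [c cT]]; exists (complex.Re `|c|); first exact: ler_Re (normr_ge0 c).
move=> x; rewrite RRe_real ?normr_real //.
have : 0 <= c * `|x| := le_trans (normr_ge0 _) (cT x).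
by move=> /ger0_norm; rewrite normrM normr_id => ->.
Qed.

Lemma bounded_operators_lincomb (a : R[i]) T T' :
  bounded_operators T -> bounded_operators T' ->
  bounded_operators (fun x => a *: T x + T' x).
Proof.
move=> bT bT'; split.
  move=> b x y; rewrite (bounded_operatorD bT) (bounded_operatorD bT').
  rewrite (bounded_operatorZ bT) (bounded_operatorZ bT').
  by rewrite !scalerDr !scalerA mulrC addrACA.
have [[_ [c cT]] [_ [c' cT']]] := (bT, bT').
exists (`|a| * c + c') => x; rewrite mulrDl -mulrA.
apply: le_trans (ler_normD _ _) _.
by rewrite normrZ lerD // ler_wpM2l.
Qed.

(** Riesz represents [x |-> <T x, y>] for each [y], and choice collects the representing vectors
    into [g]. Linearity of [g] follows by testing against all vectors. *)
Lemma hadjoint_spec T : bounded_operators T ->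
  bounded_operators (hadjoint T) /\ forall x y, '[T x, y] = '[x, hadjoint T y].
Proof.
move=> bT.
suff ex : exists T', bounded_operators T' /\ forall x y, '[T x, y] = '[x, T' y].
  exact: (xgetPex (fun=> 0) ex).
have [k k0 kT] := bounded_operator_constant _ bT.
have k0' : 0 <= k%:C%C by rewrite lecR.
have /choice[g gT] : forall y, exists z, forall x, '[T x, y] = '[x, z].
  move=> y; apply: (@Riesz_representation _ _ _ (k * rnorm y)).
  - by move=> x x'; rewrite (bounded_operatorD bT) innerDl.
  - by move=> a x; rewrite (bounded_operatorZ bT) innerZl.
  - by rewrite mulr_ge0 // rnorm_ge0.
  - move=> x; apply: le_trans (inner_CauchySchwarz _ _) _.
    by rewrite rmorphM /= -normE mulrAC ler_wpM2r.
have gT' x y : '[g y, x] = '[y, T x] by rewrite innerC -gT -innerC.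
exists g; split=> [|x y]; last exact: gT.
split=> [a x y|].
  by apply: inner_injl => z; rewrite gT' !innerDl !innerZl !gT'.
(* The bound of [T] serves for [g]: [|g y|^2 = <T (g y), y> <= k |g y| |y|], and [|g y|] is
   cancelled. *)
exists k%:C%C => y; have [->|gy0] := eqVneq (g y) 0.
  by rewrite normr0 mulr_ge0.
have ngy : 0 < `|g y| by rewrite normr_gt0.
rewrite -(ler_pM2l ngy) -expr2 -inner_norm -gT.
have CS := inner_CauchySchwarz (T (g y)) y.
have : 0 <= '[T (g y), y] by rewrite gT inner_norm exprn_ge0.
move=> /ger0_norm <-; apply: le_trans CS _.
by rewrite mulrA (mulrC `|g y|) ler_wpM2r.
Qed.

Lemma inner_hadjoint {T} (bT : bounded_operators T) x y :
  '[hadjoint T x, y] = '[x, T y].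
Proof. by have [_ TE] := hadjoint_spec _ bT; rewrite innerC -TE -innerC. Qed.

Lemma hadjoint_lincomb (a : R[i]) T T' x :
  bounded_operators T -> bounded_operators T' ->
  hadjoint (fun x => a *: T x + T' x) x =
  Num.conj a *: hadjoint T x + hadjoint T' x.
Proof.
move=> bT bT'; apply: inner_injl => z.
rewrite (inner_hadjoint (bounded_operators_lincomb a _ _ bT bT')).
rewrite innerDl innerDr innerZl innerZr.
by rewrite (inner_hadjoint bT) (inner_hadjoint bT').
Qed.

Lemma inner_hadjoint_commute T T' xi :
  bounded_operators T -> bounded_operators T' -> T \o T' = T' \o T ->
  '[hadjoint T xi, T' xi] = '[hadjoint T' xi, T xi].
Proof.
move=> bT bT' TT'; rewrite (inner_hadjoint bT) (inner_hadjoint bT').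
by rewrite -[T (T' xi)]/((T \o T') xi) TT'.
Qed.

Definition lincomb_closed K := forall (a : R[i]) m n,
  K m -> K n -> K (fun x => a *: m x + n x).

Lemma commutant_id (M : set (H -> H)) : commutant M id.
Proof.
split=> //; split=> //.
by exists 1 => x; rewrite mul1r.
Qed.

Lemma commutant_lincomb_closed (M : set (H -> H)) :
  M `<=` bounded_operators -> lincomb_closed (commutant M).
Proof.
move=> bM a m n [bm mM] [bn nM]; split; first exact: bounded_operators_lincomb.
move=> T MT; apply/funext => x /=; have bT := bM _ MT.
rewrite (bounded_operatorD bT) (bounded_operatorZ bT).
by rewrite -[m (T x)]/((m \o T) x) -[n (T x)]/((n \o T) x) mM // nM.
Qed.

(** Stated for two commuting families so that it applies to an algebra and its commutant in either
    order. Density of [L xi] makes the graph single-valued. *)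
Lemma S_op_conjugate_linear K L xi :
  K `<=` bounded_operators -> L `<=` bounded_operators ->
  (forall m l, K m -> L l -> m \o l = l \o m) ->
  K id -> lincomb_closed K -> cyclic_vector L xi ->
  conjugate_linear_operator (S_op K xi).
Proof.
move=> bK bL KL K1 KD dL; split.
(* [lincomb_closed] only provides the form [a m + n], so zero is written [- id + id], and below
   [a m] is written [(a - 1) m + m]. *)
- exists (fun x => -1 *: x + x); first exact: (KD (-1) id id).
  rewrite (hadjoint_lincomb _ _ _ _ (bK _ K1) (bK _ K1)) rmorphN1 !scaleN1r.
  by rewrite !addNr.
- move=> _ _ _ _ [m Km [<- <-]] [n Kn [<- <-]].
  exists (fun x => 1 *: m x + n x); first exact: KD.
  by rewrite (hadjoint_lincomb _ _ _ _ (bK _ Km) (bK _ Kn)) rmorph1 !scale1r.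
- move=> a _ _ [m Km [<- <-]]; exists (fun x => (a - 1) *: m x + m x).
    exact: KD.
  rewrite (hadjoint_lincomb _ _ _ _ (bK _ Km) (bK _ Km)).
  by rewrite rmorphB rmorph1 !scalerBl !scale1r !subrK.
- move=> x _ _ [m Km [<- <-]] [n Kn [nm <-]].
  apply/subr0_eq/(dense_orthogonal0 _ _ dL) => _ [l Ll <-].
  rewrite innerBl.
  rewrite (inner_hadjoint_commute _ _ _ (bK _ Km) (bL _ Ll) (KL _ _ Km Ll)).
  rewrite (inner_hadjoint_commute _ _ _ (bK _ Kn) (bL _ Ll) (KL _ _ Kn Ll)).
  by rewrite nm subrr.
Qed.

Lemma S_op_symmetric_pair K L xi :
  K `<=` bounded_operators -> L `<=` bounded_operators ->
  (forall m l, K m -> L l -> m \o l = l \o m) ->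
  K id -> lincomb_closed K -> cyclic_vector K xi ->
  L id -> lincomb_closed L -> cyclic_vector L xi ->
  symmetric_pair (S_op K xi) (S_op L xi).
Proof.
move=> bK bL KL K1 KD dK L1 LD dL.
have domE (N : set (H -> H)) : domain (S_op N xi) = Defs.orbit N xi.
  apply/seteqP; split=> [_ [_ [m Nm <-] <-]|_ [m Nm <-]]; first by exists m.
  by exists (m xi, hadjoint m xi) => //; exists m.
split; rewrite /densely_defined ?domE //.
- exact: (S_op_conjugate_linear _ L).
- apply: (S_op_conjugate_linear _ K) => // m l Lm Kl; exact/esym/KL.
- move=> _ _ _ _ [m Km [<- <-]] [l Ll [<- <-]].
  rewrite -innerC.
  exact: (inner_hadjoint_commute _ _ _ (bK _ Km) (bL _ Ll) (KL _ _ Km Ll)).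
Qed.

End Adjoint.

(** * Symmetric pairs, closedness of adjoints, closability *)

Section SymmetricPair.
Context {R : realType}.
Implicit Types H : hilbertType R.

Lemma symmetric_pairC H1 H2 (A : set (H1 * H2)) (B : set (H2 * H1)) :
  symmetric_pair A B -> symmetric_pair B A.
Proof.
move=> [cA dA cB dB AB]; split=> // psi Bpsi phi Aphi Bp Ap.
by rewrite (innerC psi) (AB _ _ _ _ Ap Bp) !conjCK -innerC.
Qed.

Lemma symmetric_pair_adjoint H1 H2 (A : set (H1 * H2)) (B : set (H2 * H1)) :
  symmetric_pair A B -> B `<=` adjoint A.
Proof. by move=> [_ _ _ _ AB] [psi Bpsi] ? phi Aphi ?; exact: AB. Qed.

Lemma adjoint_functional H1 H2 (A : set (H1 * H2)) psi y1 y2 :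
  densely_defined A -> adjoint A (psi, y1) -> adjoint A (psi, y2) -> y1 = y2.
Proof.
move=> dA A1 A2; apply/subr0_eq/(dense_orthogonal0 _ _ dA).
move=> _ [[phi Aphi] Ap <-] /=; rewrite innerBl !(innerC _ phi).
by rewrite -(A1 _ _ Ap) -(A2 _ _ Ap) subrr.
Qed.

(** Each point of the graph of [A] imposes one equation, continuous in [q], so the adjoint is an
    intersection of closed sets. Exchanging the arguments of one inner product absorbs the
    conjugation. *)
Lemma adjoint_closed H1 H2 (A : set (H1 * H2)) : closed (adjoint A).
Proof.
have -> : adjoint A = \bigcap_(p in A) [set q | '[p.2, q.1] = '[q.2, p.1]].
  apply/seteqP; split=> [q Aq [phi Aphi] Ap /=|q Aq phi Aphi Ap].
    by rewrite (Aq _ _ Ap) -innerC.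
  by rewrite (Aq _ Ap) /= -innerC.
apply: closed_bigI => p _.
pose g (q : H2 * H1) : R[i]^o := '[p.2, q.1] - '[q.2, p.1].
have -> : [set q | '[p.2, q.1] = '[q.2, p.1]] = g @^-1` [set 0].
  apply/seteqP; split=> q /=; rewrite /g.
    by move=> ->; rewrite subrr.
  exact: subr0_eq.
apply: preimage_closed => [q _|].
  apply: cvgB.
    apply: (@continuous_comp _ _ _ fst (fun y => '[p.2, y] : R[i]^o) q).
      exact: cvg_fst.
    exact: inner_continuous_r.
  apply: (@continuous_comp _ _ _ snd (fun y => '[y, p.1] : R[i]^o) q).
    exact: cvg_snd.
  exact: inner_continuous_l.
exact/accessible_closed_set1/hausdorff_accessible/norm_hausdorff.
Qed.

(** Conjugate-linearity passes to the closure by continuity of the vector operations;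
    single-valuedness is inherited from [adjoint B], which contains the closure. *)
Lemma symmetric_pair_closable H1 H2 (A : set (H1 * H2)) (B : set (H2 * H1)) :
  symmetric_pair A B -> closable A.
Proof.
move=> AB; have [[A0 AD AZ _] _ _ dB _] := AB.
have clA : closure A `<=` adjoint B.
  rewrite [X in _ `<=` X](closure_id _).1; last exact: adjoint_closed.
  exact/closureS/symmetric_pair_adjoint/symmetric_pairC.
split.
- exact: subset_closure.
(* Continuity of addition provides neighbourhoods [V1], [V2] of the two points whose sums lie in
   [U]; each of them meets [A]. *)
- move=> x1 y1 x2 y2 A1 A2 U U12.
  have cf : (fun q : (H1 * H2) * (H1 * H2) => (q.1.1 + q.2.1, q.1.2 + q.2.2)) q
      @[q --> ((x1, y1), (x2, y2))] --> (x1 + x2, y1 + y2).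
    by apply: cvg_pair; apply: cvgD;
      apply: cvg_comp; (exact: cvg_fst || exact: cvg_snd).
  have /= [[V1 V2] [/= V1n V2n] V12] := cf _ U12.
  have [[u1 v1] [Au Vu]] := A1 _ V1n; have [[u2 v2] [Av Vv]] := A2 _ V2n.
  by exists (u1 + u2, v1 + v2); split; [exact: AD|exact: (V12 ((u1, v1), (u2, v2)))].
- move=> a x y Axy U Ua.
  have /= cf : (fun q : H1 * H2 => (a *: q.1, Num.conj a *: q.2)) q
     @[q --> (x, y)] --> (a *: x, Num.conj a *: y).
    by apply: cvg_pair; apply: cvgZr; [exact: cvg_fst|exact: cvg_snd].
  have [[u v] [Au Uu]] := Axy _ (cf _ Ua).
  by exists (a *: u, Num.conj a *: v); split=> //; exact: AZ.
- by move=> x y1 y2 /clA A1 /clA A2; exact: adjoint_functional dB A1 A2.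
Qed.

End SymmetricPair.

Theorem theorem4p6 (R : realType) (H : hilbertType R) (M : set (H -> H))
    (xi : H) (vN : von_neumann_algebra M) (xi_unit : `|xi| = 1)
    (xi_cyc : cyclic_vector M xi) (xi_sep : separating_vector M xi) :
  [/\ symmetric_pair (S_op M xi) (F_op M xi),
      closable (S_op M xi),
      closable (F_op M xi),
      S_op M xi `<=` adjoint (F_op M xi) &
      F_op M xi `<=` adjoint (S_op M xi)].
Proof.
case: vN => -[bM M1 MD _ _] _.
have SF : symmetric_pair (S_op M xi) (F_op M xi).
  (* By definition [F_op M xi] is [S_op (commutant M) xi], and [xi] separating for [M] means cyclic
     for [commutant M]. *)
  apply: S_op_symmetric_pair => //.
  - by move=> m [].
  - by move=> m l Mm [_ lM]; rewrite lM.
  - exact: commutant_id.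
  - exact: commutant_lincomb_closed.
have FS := symmetric_pairC _ _ _ _ SF.
split=> //.
- exact: symmetric_pair_closable SF.
- exact: symmetric_pair_closable FS.
- exact: symmetric_pair_adjoint FS.
- exact: symmetric_pair_adjoint SF.
Qed.
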